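(* Let $Q$ be a simple graph of maximum degree $\Delta\ge2$ and $M$ be a simple graph of tree-width $k$. Assume that a graph $G$ is a subgraph (not necessarily induced) of the strong product $Q\boxtimes M$. Then: a) There exists a graph $M_1$ of clique-width $\ell\le(\Delta^2+2)\cdot\Delta^{2(\Delta+1)(k+1)}$ such that $G$ is isomorphic to an induced subgraph of the strong product $Q\boxtimes M_1$. In particular, if $\mathcal H$ is a class of loop graphs containing the reflexive closure of $Q$, then the $\mathcal H$-clique-width of $G$ is at most $\ell$. b) There exists a graph $M_2$ of tree-width $\ell'\le(k+1)(\Delta^2+1)\cdot\Delta^{2(\Delta+1)(k+1)}$ such that $G$ is isomorphic to an induced subgraph of the strong product $Q\boxtimes M_2$. Furthermore, if the square of the graph $Q$ is $d$-colourable, then the graph $M_1$ can be chosen to have clique-width $\ell\le(d+1)\left(\min\left((d-1)^{(\Delta+1)},\,2^d\right)\right)^{k+1}$, and the graph $M_2$ can be chosen of tree-width $\ell'\le(k+1)\,d\left(\min\left((d-1)^{(\Delta+1)},\,2^d\right)\right)^{k+1}$.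
   Context: All graphs are finite. Simple graphs have no loops and no parallel edges; a loop graph has no parallel edges, but may have at most one loop per vertex. The reflexive closure of $Q$ is $Q$ with a loop added to every vertex. $G$, $M_1$, $M_2$ are simple graphs. The square $Q^2$ of $Q$ has vertex set $V(Q)$ and edges between all pairs of vertices at distance $1$ or $2$ in $Q$. The strong product $G_1\boxtimes G_2$ of simple graphs has vertex set $V(G_1)\times V(G_2)$, and $[u,u'],[v,v']$ are adjacent iff ($uv\in E(G_1)$ and $u'v'\in E(G_2)$) or ($u=v$ and $u'v'\in E(G_2)$) or ($uv\in E(G_1)$ and $u'=v'$). Tree-width is the usual notion (maximum bag size minus one, minimised over tree decompositions). Clique-width: the least $\ell$ such that the graph (irrespective of labels) is the value of an $\ell$-expression built with the operations: create a new vertex of label $i\in\{1,\dots,\ell\}$; disjoint union of two labelled graphs; for $i\ne j$, add all missing edges between vertices of label $i$ and vertices of label $j$; for $i\neq j$, relabel all vertices of label $i$ to label $j$. $\mathcal H$-clique-width: for $H\in\mathcal H$ and an integer $\ell>0$, an $(H,\ell)$-expression is an algebraic expression on graphs whose vertices carry labels $(i,v)$ with $i\in\{1,\dots,\ell\}$ and $v\in V(H)$, using the operations: create a new vertex with a single label $(i,v)$; disjoint union of two labelled graphs; for $1\le i\ne j\le\ell$, add all edges between the vertices of label $(i,v)$ and the vertices of label $(j,w)$ over all pairs $(v,w)\in V(H)\times V(H)$ with $vw\in E(H)$ (including $v=w$ when $v$ has a loop in $H$); for $1\le i\neq j\le\ell$, relabel every vertex with label $(i,v)$, $v\in V(H)$,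 to $(j,v)$. The $\mathcal H$-clique-width of a simple graph $G$ is the smallest $\ell$ such that (some labelling of) $G$ is the value of an $(H,\ell)$-expression for some $H\in\mathcal H$, and $\infty$ if there is no such $\ell$. *)

(* Defs.v *)
From mathcomp Require Import all_boot.

Set Implicit Arguments.
Unset Strict Implicit.
Unset Printing Implicit Defensive.

Definition is_least (P : nat -> Prop) (n : nat) : Prop :=
  P n /\ forall m, P m -> n <= m.

(** * Graphs *)

Record sgraph := SGraph {
  svertex :> finType;
  sedge : rel svertex;
  sedge_sym : symmetric sedge;
  sedge_irr : irreflexive sedge }.

Record lgraph := LGraph {
  lvertex :> finType;
  ledge : rel lvertex;
  ledge_sym : symmetric ledge }.

Section ReflexiveClosure.
Variable Q : sgraph.
Definition refl_rel : rel Q := fun x y => (x == y) || sedge x y.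
Lemma refl_rel_sym : symmetric refl_rel.
Proof. by move=> x y; rewrite /refl_rel eq_sym sedge_sym. Qed.
Definition reflexive_closure : lgraph := LGraph refl_rel_sym.
End ReflexiveClosure.

Section Induced.
Variables (G : sgraph) (S : {set G}).
Definition induced_rel : rel {x : G | x \in S} :=
  fun x y => sedge (val x) (val y).
Lemma induced_rel_sym : symmetric induced_rel.
Proof. by move=> x y; apply: sedge_sym. Qed.
Lemma induced_rel_irr : irreflexive induced_rel.
Proof. by move=> x; apply: sedge_irr. Qed.
Definition induced : sgraph := SGraph induced_rel_sym induced_rel_irr.
End Induced.

Definition isomorphic (G1 G2 : sgraph) : Prop :=
  exists2 f : G1 -> G2, bijective f &
    forall x y, sedge (f x) (f y) = sedge x y.

Definition iso_induced_subgraph (G P : sgraph) : Prop :=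
  exists S : {set P}, isomorphic G (induced S).

(* Vertex sets are types, so being a subgraph is being one up to isomorphism:
   there is an injective homomorphism. *)
Definition subgraph (G P : sgraph) : Prop :=
  exists2 f : G -> P, injective f &
    forall x y, sedge x y -> sedge (f x) (f y).

Section StrongProduct.
Variables G1 G2 : sgraph.
Definition strong_rel : rel (G1 * G2) := fun x y =>
  [|| sedge x.1 y.1 && sedge x.2 y.2,
      (x.1 == y.1) && sedge x.2 y.2
    | sedge x.1 y.1 && (x.2 == y.2)].
Lemma strong_rel_sym : symmetric strong_rel.
Proof.
move=> x y; rewrite /strong_rel (sedge_sym x.1) (sedge_sym x.2).
by rewrite (eq_sym x.1) (eq_sym x.2).
Qed.
Lemma strong_rel_irr : irreflexive strong_rel.
Proof. by move=> x; rewrite /strong_rel !sedge_irr /= andbF. Qed.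
Definition strong_product : sgraph := SGraph strong_rel_sym strong_rel_irr.
End StrongProduct.

Definition max_degree (G : sgraph) : nat :=
  \max_(x : G) #|[set y | sedge x y]|.

Section Square.
Variable Q : sgraph.
Definition walk (n : nat) (x y : Q) : bool :=
  [exists p : n.-tuple Q, path (@sedge Q) x p && (last x p == y)].
Definition at_distance (n : nat) (x y : Q) : bool :=
  walk n x y && [forall m : 'I_n, ~~ walk m x y].
Definition square_rel : rel Q :=
  fun x y => at_distance 1 x y || at_distance 2 x y.

Lemma walk_sym n : symmetric (walk n).
Proof.
suff W x y : walk n x y -> walk n y x by move=> x y; apply/idP/idP; apply: W.
case/existsP=> p /andP[pP /eqP <-]; apply/existsP.
have sz : size (rev (belast x p)) == n by rewrite size_rev size_belast size_tuple.
exists (Tuple sz); rewrite /= rev_path.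
rewrite (eq_path (e' := @sedge Q)) ?pP /=; last by move=> u v; apply: sedge_sym.
by case: (tval p) => [|z s] //=; rewrite rev_cons last_rcons.
Qed.
Lemma square_rel_sym : symmetric square_rel.
Proof.
move=> x y; rewrite /square_rel /at_distance.
rewrite 2!(walk_sym _ x y); congr (_ && _ || _ && _);
  by apply: eq_forallb => m; rewrite walk_sym.
Qed.
Lemma square_rel_irr : irreflexive square_rel.
Proof.
have W x : walk 0 x x by apply/existsP; exists [tuple]; rewrite /= eqxx.
have D n x : at_distance n.+1 x x = false.
  apply/negP=> /andP[_ /forallP/(_ ord0)]; by rewrite W.
by move=> x; rewrite /square_rel !D.
Qed.
Definition square : sgraph := SGraph square_rel_sym square_rel_irr.
End Square.

Definition colourable (G : sgraph) (d : nat) : Prop :=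
  exists c : G -> 'I_d, forall x y, sedge x y -> c x != c y.

(** * Tree-width *)

(* The null graph is connected under this definition, but is not a tree. *)
Definition connected (G : sgraph) : Prop :=
  forall x y : G, connect (@sedge G) x y.

Definition acyclic (G : sgraph) : Prop :=
  forall c : seq G, 2 < size c -> ~ ucycle (@sedge G) c.

Definition is_tree (T : sgraph) : Prop :=
  [/\ 0 < #|T|, connected T & acyclic T].

Definition tree_decomposition (G T : sgraph) (B : T -> {set G}) : Prop :=
  [/\ is_tree T,
      forall v : G, exists t, v \in B t,
      forall u v : G, sedge u v -> exists t, (u \in B t) && (v \in B t)
    & forall v : G, connected (induced [set t | v \in B t])].

(* The predecessor is truncated, so the null graph has tree-width 0. *)
Definition bag_width (G T : sgraph) (B : T -> {set G}) : nat :=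
  (\max_(t : T) #|B t|).-1.

Definition treewidth (G : sgraph) : nat -> Prop :=
  is_least (fun w => exists (T : sgraph) (B : T -> {set G}),
    tree_decomposition B /\ bag_width B = w).

(** * Labelled graphs *)

Record labelled (L : Type) := Labelled {
  lbase :> sgraph;
  label : lbase -> L }.

Section SingleVertex.
Lemma unit_rel_sym : symmetric (fun _ _ : unit => false). Proof. by []. Qed.
Lemma unit_rel_irr : irreflexive (fun _ _ : unit => false). Proof. by []. Qed.
Definition single_graph : sgraph := SGraph unit_rel_sym unit_rel_irr.
Definition single (L : Type) (a : L) : labelled L :=
  @Labelled L single_graph (fun _ => a).
End SingleVertex.

Section DisjointUnion.
Variables G1 G2 : sgraph.
Definition union_rel : rel (G1 + G2) := fun x y =>
  match x, y with
  | inl x1, inl y1 => sedge x1 y1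
  | inr x2, inr y2 => sedge x2 y2
  | _, _ => false
  end.
Lemma union_rel_sym : symmetric union_rel.
Proof. by move=> [x|x] [y|y] //=; apply: sedge_sym. Qed.
Lemma union_rel_irr : irreflexive union_rel.
Proof. by move=> [x|x] /=; apply: sedge_irr. Qed.
Definition union_graph : sgraph := SGraph union_rel_sym union_rel_irr.
End DisjointUnion.

Definition lunion (L : Type) (G1 G2 : labelled L) : labelled L :=
  @Labelled L (union_graph G1 G2)
    (fun x => match x with inl x1 => label x1 | inr x2 => label x2 end).

(* Adds all edges between a vertex of label a and a vertex of label b with
   r a b.  The guard x != y only serves irreflexivity: it is implied by the
   rest for the relations used below, which relate no label to itself. *)
Section Join.
Variables (L : Type) (r : rel L) (G : labelled L).
Definition join_rel : rel G := fun x y =>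
  sedge x y ||
  ((x != y) && (r (label x) (label y) || r (label y) (label x))).
Lemma join_rel_sym : symmetric join_rel.
Proof. by move=> x y; rewrite /join_rel sedge_sym eq_sym (orbC (r _ _)). Qed.
Lemma join_rel_irr : irreflexive join_rel.
Proof. by move=> x; rewrite /join_rel sedge_irr eqxx. Qed.
Definition join_graph : sgraph := SGraph join_rel_sym join_rel_irr.
Definition ljoin : labelled L := @Labelled L join_graph (@label L G).
End Join.

Definition lrelabel (L : Type) (f : L -> L) (G : labelled L) : labelled L :=
  @Labelled L G (fun x => f (label x)).

(** * Clique-width *)

Inductive cexpr (l : nat) : Type :=
| CVertex (i : 'I_l)
| CUnion (e1 e2 : cexpr l)
| CJoin (i j : 'I_l) (neq_ij : i != j) (e : cexpr l)
| CRelabel (i j : 'I_l) (neq_ij : i != j) (e : cexpr l).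

Fixpoint cvalue (l : nat) (e : cexpr l) : labelled 'I_l :=
  match e with
  | CVertex i => single i
  | CUnion e1 e2 => lunion (cvalue e1) (cvalue e2)
  | CJoin i j _ e => ljoin (fun a b => (a == i) && (b == j)) (cvalue e)
  | CRelabel i j _ e => lrelabel (fun a => if a == i then j else a) (cvalue e)
  end.

(* No expression has the null graph as its value; by convention its
   clique-width (and, below, its H-clique-width, provided that the class is
   not empty) is the least admissible value 1. *)
Definition clique_width (G : sgraph) : nat -> Prop :=
  is_least (fun l => 0 < l /\
    (#|G| = 0 \/ exists e : cexpr l, isomorphic G (cvalue e))).

Inductive hexpr (H : lgraph) (l : nat) : Type :=
| HVertex (i : 'I_l) (v : H)
| HUnion (e1 e2 : hexpr H l)
| HJoin (i j : 'I_l) (neq_ij : i != j) (e : hexpr H l)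
| HRelabel (i j : 'I_l) (neq_ij : i != j) (e : hexpr H l).

Fixpoint hvalue (H : lgraph) (l : nat) (e : hexpr H l) : labelled ('I_l * H) :=
  match e with
  | HVertex i v => single (i, v)
  | HUnion e1 e2 => lunion (hvalue e1) (hvalue e2)
  | HJoin i j _ e =>
      ljoin (fun a b => [&& a.1 == i, b.1 == j & ledge a.2 b.2]) (hvalue e)
  | HRelabel i j _ e =>
      lrelabel (fun a => if a.1 == i then (j, a.2) else a) (hvalue e)
  end.

(* The width is infinite when no l satisfies [hclique_width HH G l]. *)
Definition hclique_width (HH : lgraph -> Prop) (G : sgraph) : nat -> Prop :=
  is_least (fun l => 0 < l /\ exists2 H : lgraph, HH H &
    (#|G| = 0 \/ exists e : hexpr H l, isomorphic G (hvalue e))).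

(* Main.v *)
Require Import Defs.
From mathcomp Require Import all_boot zify.
From Stdlib Require Import Classical.

(* Let [c] colour the square of [Q], so that [c] is injective on each closed
   neighbourhood of [Q], and orient [M] by a perfect elimination ordering of a
   chordal supergraph [chord] in which each vertex has at most [k] earlier
   neighbours; [chord] has a proper colouring [col] with [k + 1] colours.  For a
   vertex [x] of [G] over [(q, m)], its code records, for each colour [p] of
   [col], the set of [c]-colours of the neighbours of [x] in [G] lying over
   vertices of [M] that are [m] or earlier than [m] and have colour [p].  Such a
   vertex of [M] is unique if it exists, and in a closed neighbourhood of [Q] the
   colour determines the vertex, so adjacency of [x] and [y] in [G] can be read
   off from [m], [c q] and the code of both once [q_x] and [q_y] are known to be
   equal or adjacent.

   For tree-width, [M2] is the graph of all triples (vertex of [M], colour,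
   code): each bag is blown up by the number of pairs (colour, code).  For
   clique-width, [M1] lives on the vertices of [G] and is built along the
   elimination forest from the leaves up.  A vertex over the [M]-vertex being
   processed is labelled by its colour and code, an older one by its code alone,
   erased where it refers to vertices already processed.  Since [M1] has the same
   vertices as [G], its expression becomes one for [G] over the reflexive closure
   of [Q] by decorating each new vertex [x] with [q_x]. *)

Set Implicit Arguments.
Unset Strict Implicit.
Unset Printing Implicit Defensive.

(** * Least witnesses and the number of small colour sets *)

Lemma ex_is_least (P : nat -> Prop) n :
  P n -> exists2 m, is_least P m & m <= n.
Proof.
elim/ltn_ind: n => n IHn Pn.
case: (classic (exists2 m, P m & m < n)) => [[m Pm lt_mn]|noP].
  by have [l lP le_lm] := IHn _ lt_mn Pm; exists l => //; lia.
exists n => //; split=> // m Pm; rewrite leqNgt; apply/negP=> lt_mn.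
by apply: noP; exists m.
Qed.

(** Induction on [d] by Pascal's rule: [(d - 1)^(n + 1) + (d - 1)^n = d (d - 1)^n], which is at most
    [d^(n + 1)]. The inequality is false for [d = 3], [n = 2], so [d = 3] and [n = 3] are separate
    base cases, the latter through the closed form [f2]. *)
Lemma sum_bin_leq d n : 2 < d -> 2 < n ->
  \sum_(i < n.+1) 'C(d, i) <= (d - 1) ^ n.
Proof.
pose f d n := \sum_(i < n.+1) 'C(d, i); rewrite -/(f d n).
have fS m j : f m.+1 j.+1 = f m j.+1 + f m j.
  rewrite /f big_ord_recl bin0 [in RHS]big_ord_recl bin0 -addnA; congr (_ + _).
  by rewrite -big_split; apply: eq_bigr => i _; rewrite /= /bump binS.
have f2 m : 2 * f m 2 = m ^ 2 + m + 2.
  rewrite /f !big_ord_recr big_ord0 /= bin0 bin1.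
  have := mul_bin_diag m 1.
  by case: m => [|m]; rewrite ?bin1 /=; nia.
elim: d n => // d IHd n; case: (ltnP 2 d) => [d2 _ n2|d2 dd]; last first.
  have -> : d = 2 by lia.
  case: n => // n n2; have: f 3 n.+1 <= 2 ^ 3; last first.
    by move=> /leq_trans -> //; rewrite leq_exp2l.
  rewrite fS; have f2' j : f 2 j <= 4.
    case: j => [|[|j]]; rewrite /f; [by rewrite !big_ord_recl big_ord0..|].
    by rewrite 3!big_ord_recl big1 // => i _; rewrite bin_small.
  by rewrite -[2 ^ 3]/(4 + 4); apply: leq_add.
case: n n2 => // n; rewrite ltnS leq_eqVlt => /orP[/eqP <-|n2].
  by rewrite fS; have := IHd 3 d2 isT; have := f2 d; rewrite !expnS expn0; nia.
rewrite fS subn1 /= expnS.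
have := IHd n.+1 d2 (ltnW n2); have := IHd n d2 n2.
have: (d - 1) ^ n <= d ^ n by rewrite leq_exp2r //; lia.
by rewrite expnS; nia.
Qed.

Lemma card_small_sets (T : finType) n :
  #|{: {A : {set T} | #|A| <= n}}| = \sum_(i < n.+1) 'C(#|T|, i).
Proof.
rewrite card_sig; elim: n => [|n IHn].
  by rewrite big_ord1 -card_draws; apply: eq_card => A; rewrite !inE leqn0.
rewrite big_ord_recr /= -IHn -card_draws.
rewrite -[LHS](cardID [pred A : {set T} | #|A| <= n]) /=; congr (_ + _);
  apply: eq_card => A; rewrite !inE; lia.
Qed.

Lemma card_small_sets_leq d n : 2 < d -> 2 < n ->
  #|{: {A : {set 'I_d} | #|A| <= n}}| <= minn ((d - 1) ^ n) (2 ^ d).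
Proof.
move=> d2 n2; rewrite leq_min; apply/andP; split.
  by rewrite card_small_sets card_ord sum_bin_leq.
rewrite card_sig (leq_trans (max_card _)) //.
by rewrite -cardsT -powersetT card_powerset cardsT card_ord.
Qed.

(** * Greedy colouring and the square *)

(** Colour in order of increasing key: the at most [n] earlier neighbours leave one of the [n + 1]
    colours free. It serves both the square of [Q] and the chordal supergraph of [M]. *)
Lemma greedy_colouring (T : finType) (e : rel T) (key : T -> nat) n :
    symmetric e -> irreflexive e -> injective key ->
    (forall z, #|[set a | e a z & key a < key z]| <= n) ->
  exists c : T -> 'I_n.+1, forall x y, e x y -> c x != c y.
Proof.
move=> eC eI keyI few.
suff Hj j : exists c : T -> 'I_n.+1, forall x y, key x < j -> key y < j ->
    e x y -> c x != c y.
  have [c cP] := Hj (\max_x key x).+1; exists c => x y.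
  by apply: cP; rewrite ltnS leq_bigmax.
elim: j => [|j [c cP]]; first by exists (fun _ => ord0).
case: (pickP [pred v | key v == j]) => [v /eqP vj|no_v]; last first.
  have no x : key x < j.+1 -> key x < j.
    by rewrite ltnS leq_eqVlt; have /= -> := no_v x.
  by exists c => x y /no xj /no yj; apply: cP.
have [i Hi] : exists i, i \notin c @: [set a | e a v & key a < key v].
  apply/existsP; rewrite -negb_forall; apply/negP=> /forallP all_i.
  have := leq_trans (leq_imset_card c _) (few v).
  by rewrite (_ : _ @: _ = setT) ?cardsT ?card_ord ?ltnn //; apply/setP=> i; rewrite all_i inE.
have iP a : e a v -> key a < j -> c a != i.
  move=> eav aj; apply: contra Hi => /eqP <-; apply: imset_f.
  by rewrite inE eav vj.
have keyN x : x != v -> key x < j.+1 -> key x < j.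
  by move=> xv; rewrite ltnS leq_eqVlt -vj (inj_eq keyI) (negPf xv).
exists (fun x => if x == v then i else c x) => x y.
case: (eqVneq x v) (eqVneq y v) => [->|xv] [->|yv] xj yj exy.
- by rewrite eI in exy.
- by rewrite eq_sym; apply: iP; rewrite 1?eC // keyN.
- by apply: iP; rewrite // keyN.
- by apply: cP; rewrite // keyN.
Qed.

Lemma degree_leq (G : sgraph) (x : G) :
  #|[set y | sedge x y]| <= max_degree G.
Proof. exact: leq_bigmax. Qed.

Lemma walk1P (Q : sgraph) (x y : Q) : reflect (sedge x y) (walk 1 x y).
Proof.
apply: (iffP existsP) => [[p] | xy].
  case/tupleP: p => z p; rewrite (tuple0 p) /= andbT.
  by case/andP=> xz /eqP <-.
by exists [tuple y]; rewrite /= xy eqxx.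
Qed.

Lemma walk2P (Q : sgraph) (x y : Q) :
  reflect (exists2 z, sedge x z & sedge z y) (walk 2 x y).
Proof.
apply: (iffP existsP) => [[p] | [z xz zy]].
  case/tupleP: p => z p; case/tupleP: p => t p; rewrite (tuple0 p) /= andbT.
  by case/andP=> /andP[xz zt] /eqP <-; exists z.
by exists [tuple z; y]; rewrite /= xz zy eqxx.
Qed.

Lemma square_sedge (Q : sgraph) (q a b : Q) :
  refl_rel q a -> refl_rel q b -> a != b -> @sedge (square Q) a b.
Proof.
move=> qa qb ab; have w0 : ~~ walk 0 a b.
  by apply/negP=> /existsP[p]; rewrite (tuple0 p) /= (negPf ab).
rewrite /= /square_rel /at_distance.
have -> : [forall m : 'I_1, ~~ walk m a b] by apply/forallP=> m; rewrite ord1.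
case w1: (walk 1 a b) => //=.
apply/andP; split; last first.
  apply/forallP=> -[[|[|m]]] //= _; by rewrite w1.
move/walk1P: w1 => nab; apply/walk2P.
case/orP: qa => [/eqP qa|qa]; case/orP: qb => [/eqP qb|qb].
- by rewrite -qa -qb eqxx in ab.
- by rewrite -qa in nab.
- by rewrite sedge_sym -qb in nab.
- by exists q; rewrite // sedge_sym.
Qed.

Lemma card_square_nbrs (Q : sgraph) (x : Q) :
  #|[set y | @sedge (square Q) x y]| <= max_degree Q ^ 2.
Proof.
pose N z := [set y : Q | sedge z y].
(* Replacing [x] by [z] itself in the neighbourhood of [z] does not change its size, so each
   neighbour [z] of [x] accounts for at most [max_degree Q] vertices. *)
have sub : [set y | @sedge (square Q) x y] \subset
    \bigcup_(z in N x) (z |: (N z :\ x)).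
  apply/subsetP=> y; rewrite inE => xy.
  have yx : y != x by apply/eqP=> yx; rewrite yx sedge_irr in xy.
  case/orP: xy => /andP[/[swap] _].
    move/walk1P=> xy; apply/bigcupP; exists y; by rewrite !inE ?eqxx.
  move/walk2P=> [z xz zy]; apply/bigcupP; exists z; by rewrite !inE // yx zy orbT.
apply: leq_trans (subset_leq_card sub) _.
apply: (@leq_trans (\sum_(z in N x) max_degree Q)); last first.
  by rewrite sum_nat_const -mulnn leq_mul2r degree_leq orbT.
have bigcup_leq (F : Q -> {set Q}) (A : {set Q}) :
    #|\bigcup_(z in A) F z| <= \sum_(z in A) #|F z|.
  elim/big_rec2: _ => [|i n B _ leB]; first by rewrite cards0.
  by rewrite (leq_trans (leq_card_setU _ _)) // leq_add2l.
apply: leq_trans (bigcup_leq _ _) _; apply: leq_sum => z; rewrite inE => xz.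
rewrite cardsU1 (leq_trans _ (degree_leq z)) // (cardsD1 x (N z)).
by rewrite !inE sedge_sym xz leq_add2r leq_b1.
Qed.

Lemma square_colourable (Q : sgraph) : colourable (square Q) (max_degree Q ^ 2).+1.
Proof.
apply: (@greedy_colouring _ _ (fun x => enum_rank x : nat)).
- exact: sedge_sym.
- exact: sedge_irr.
- by move=> x y /val_inj/enum_rank_inj.
move=> z; apply: leq_trans (@card_square_nbrs Q z).
by apply: subset_leq_card; apply/subsetP=> a; rewrite !inE sedge_sym => /andP[].
Qed.

(** A vertex of degree at least two has a closed neighbourhood of at least three vertices, and these
    all receive distinct colours. This supplies the hypothesis [2 < d] of [card_small_sets_leq]. *)
Lemma max_degree_colours (Q : sgraph) d :
  colourable (square Q) d -> max_degree Q < 2 \/ 2 < d.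
Proof.
case=> c cP; case: (ltnP (max_degree Q) 2) => [|deg2]; [by left|right].
have [q q2] : exists q : Q, 1 < #|[set y | sedge q y]|.
  apply: NNPP => none; move: deg2; rewrite ltnNge => /negP; apply.
  apply/bigmax_leqP => q _; rewrite leqNgt; apply/negP=> q2.
  by apply: none; exists q.
rewrite -(card_ord d).
have: #|q |: [set y | sedge q y]| <= #|'I_d|.
  rewrite -(card_in_imset (f := c)) ?max_card // => a b qa qb.
  rewrite !inE [a == q]eq_sym [b == q]eq_sym in qa qb => cab.
  apply/eqP/contraT=> /(square_sedge qa qb)/cP.
  by rewrite cab eqxx.
by rewrite cardsU1 inE sedge_irr /=; lia.
Qed.

(** * Trees and perfect elimination orderings *)

Lemma path_exit (T : finType) (e : rel T) (A : {set T}) x p :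
    path e x p -> x \in A -> last x p \notin A ->
  exists a b, [/\ a \in A, b \notin A & e a b].
Proof.
elim: p x => [|y p IHp] x /=; first by move=> _ ->.
case/andP=> xy yp xA; case: (boolP (y \in A)) => [yA|yA _]; first exact: IHp.
by exists x, y.
Qed.

Section RootedTree.
Variable T : sgraph.

Definition within (A : {set T}) : rel T :=
  fun a b => [&& sedge a b, a \in A & b \in A].

Lemma path_within A x p : path (within A) x p -> {subset p <= A}.
Proof.
elim: p x => [|y p IHp] x //= /andP[/and3P[_ _ yA] /IHp pA] z.
by rewrite inE => /orP[/eqP->|/pA].
Qed.

(** A rooting of the part [A] of the tree grown so far: a root is a fixed point of [par], and [rk]
    will be the order in which vertices are added. *)
Definition rooted (A : {set T}) (par : T -> T) (rk : T -> nat) : Prop :=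
  [/\ {in A &, injective rk}, {in A, forall u, par u \in A},
      {in A, forall u, par u = u \/ rk (par u) < rk u} &
      {in A &, forall u w, sedge u w -> par u = w \/ par w = u}].

Lemma rooted_extend (A : {set T}) par rk n a z :
    acyclic T -> {in A &, forall u w, connect (within A) u w} ->
    rooted A par rk -> {in A, forall u, rk u < n} ->
    a \in A -> z \notin A -> sedge a z ->
  rooted (z |: A) (fun u => if u == z then a else par u)
    (fun u => if u == z then n else rk u).
Proof.
move=> acT conA [rkI parA parP edgeP] rk_lt aA zA az.
have AN u : u \in A -> (u == z) = false.
  by move=> uA; apply: contraNF zA => /eqP <-.
(* A second neighbour [b] of [z] in [A] would close a cycle with a path inside [A] from [a] to
   [b]. *)
have z_edge b : b \in A -> sedge z b -> a = b.
  move=> bA zb; apply/eqP/negPn/negP => ab.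
  have /connectP[p1 p0 p0b] := conA _ _ aA bA.
  case/shortenP: p0 p0b => p pP pU _ bp.
  have pT : path (@sedge T) a p by apply: sub_path pP => u w /andP[].
  apply: (acT (z :: a :: p)).
    by case: (p) bp => [|? ?] //= ba; rewrite ba eqxx in ab.
  rewrite /ucycle /cycle rcons_cons /= rcons_path pT sedge_sym az -bp sedge_sym zb /=.
  rewrite -[(a \notin p) && _]/(uniq (a :: p)) pU andbT inE negb_or eq_sym AN //=.
  by apply: contra zA; apply: path_within pP _.
split.
- move=> u w /setU1P[->|uA] /setU1P[->|wA] //; rewrite ?eqxx ?(AN u) ?(AN w) //.
  + by move=> E; have := rk_lt w wA; rewrite -E ltnn.
  + by move=> E; have := rk_lt u uA; rewrite E ltnn.
  + exact: rkI.
- move=> u /setU1P[->|uA]; rewrite ?eqxx ?(AN u) //; first exact: setU1r.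
  by apply: setU1r; apply: parA.
- move=> u /setU1P[->|uA]; rewrite ?eqxx ?(AN u) ?(AN a) //.
    by right; apply: rk_lt.
  by rewrite AN ?parA //; apply: parP.
- move=> u w /setU1P[->|uA] /setU1P[->|wA]; rewrite ?eqxx ?(AN u) ?(AN w) //.
  + by rewrite sedge_irr.
  + by move=> zw; left; apply: z_edge.
  + by rewrite sedge_sym => zu; right; apply: z_edge.
  + exact: edgeP.
Qed.

(** Start from one vertex and repeatedly add the far end of an edge leaving [A]; such an edge exists
    because the tree is connected. *)
Lemma tree_rooted : is_tree T -> exists par rk, rooted setT par rk.
Proof.
case=> T0 conT acT.
suff grow n : n < #|T| -> exists (A : {set T}) par rk,
    [/\ #|A| = n.+1, {in A &, forall u w, connect (within A) u w},
        rooted A par rk & {in A, forall u, rk u < n.+1}].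
  have [|A [par [rk [cardA _ rtA _]]]] := grow #|T|.-1; first by lia.
  exists par, rk; suff <- : A = setT by [].
  by apply/eqP; rewrite eqEcard subsetT cardsT cardA leqSpred.
elim: n => [|n IHn] ltn.
  have [r _] := card_gt0P T0; exists [set r], id, (fun _ => 0); split.
  - by rewrite cards1.
  - by move=> u w /set1P-> /set1P->; apply: connect0.
  - split=> // [u w /set1P-> /set1P-> //|u _|u w /set1P-> /set1P->]; first by left.
    by rewrite sedge_irr.
  - by [].
have [|A [par [rk [cardA conA rtA rk_lt]]]] := IHn; first exact: ltnW.
have [a0 a0A] : exists a0, a0 \in A by apply/card_gt0P; rewrite cardA.
have [z0 z0A] : exists z0, z0 \notin A.
  apply: NNPP => none; move: ltn; rewrite -cardA -cardsT.
  rewrite (_ : setT = A) ?ltnn //; apply/setP=> z; rewrite inE; symmetry.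
  by apply: contraT => zA; case: none; exists z.
have /connectP[p pP pz0] := conT a0 z0.
have [|a [z [aA zA az]]] := path_exit pP a0A; first by rewrite -pz0.
exists (z |: A), (fun u => if u == z then a else par u),
  (fun u => if u == z then n.+1 else rk u); split.
- by rewrite cardsU1 zA cardA.
- have subA : subrel (within A) (within (z |: A)).
    by move=> u w /and3P[uw uA wA]; rewrite /within uw !setU1r.
  have con u w : u \in A -> w \in A -> connect (within (z |: A)) u w.
    move=> uA wA; apply: connect_sub (conA _ _ uA wA) => x y /subA.
    exact: connect1.
  have caz : connect (within (z |: A)) a z.
    by apply: connect1; rewrite /within az setU11 setU1r.
  have cza : connect (within (z |: A)) z a.
    by apply: connect1; rewrite /within sedge_sym az setU11 setU1r.
  move=> u w /setU1P[->|uA] /setU1P[->|wA]; first exact: connect0.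
  + exact: connect_trans cza (con _ _ aA wA).
  + exact: connect_trans (con _ _ uA aA) caz.
  + exact: con.
- exact: rooted_extend.
- move=> u /setU1P[->|uA]; first by rewrite eqxx.
  by case: ifP => // _; apply: leqW; apply: rk_lt.
Qed.

Lemma connected_rooted_iter (A : {set T}) par rk (x t : T) :
    rooted setT par rk -> connected (induced A) -> x \in A -> t \in A ->
    (forall u, u \in A -> rk x <= rk u) ->
  exists2 j, iter j par t = x & forall i, i <= j -> iter i par t \in A.
Proof.
move=> [rkI _ parP edgeP] conA xA tA xmin.
have /connectP[p pP pt] := conA (exist _ x xA) (exist _ t tA).
have -> : t = val (last (exist (fun x => x \in A) x xA) p) by rewrite -pt.
move: pt => _.
(* The claim is carried along a path in [A] from [x] to [t]: a step to the parent drops the first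
   vertex of the climb to [x], a step to a child prepends one. *)
have: exists2 j, iter j par (val (exist (fun x => x \in A) x xA)) = x &
    forall i, i <= j -> iter i par (val (exist (fun x => x \in A) x xA)) \in A.
  by exists 0 => // i; rewrite leqn0 => /eqP->.
elim: p (exist _ x xA) pP => [//|w p IHp] u /= /andP[uw wp] [j jx jA].
apply: IHp wp _.
have [uw'|wu'] := edgeP (val u) (val w) (in_setT _) (in_setT _) uw.
  case: j => [|j] in jx jA *.
    (* Here the current vertex is [x]; by minimality of its rank in [A], a parent lying in [A] can
       only be [x] itself. *)
    have ux : val u = x by [].
    exists 0; last by move=> i; rewrite leqn0 => /eqP->; apply: (valP w).
    have := parP (val u) (in_setT _); rewrite uw' => -[->//|].
    by rewrite ux ltnNge xmin ?(valP w).
  exists j => [|i ij]; rewrite -uw' -iterSr //; exact: jA.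
exists j.+1 => [|[|i] ij]; last 2 first.
- exact: (valP w).
- by rewrite iterSr wu'; apply: jA.
by rewrite iterSr wu'.
Qed.

End RootedTree.

(* A perfect elimination ordering of a chordal supergraph of [M], read from the
   last vertex to the first. *)
Record elimination (M : sgraph) (k : nat) := Elimination {
  key : M -> nat;
  chord : rel M;
  key_inj : injective key;
  chord_sym : symmetric chord;
  chord_irr : irreflexive chord;
  chord_sedge : forall a b, sedge a b -> chord a b;
  chord_simplicial : forall a b z, chord a z -> chord b z ->
    key a < key z -> key b < key z -> a != b -> chord a b;
  chord_few : forall z, #|[set a | chord a z & key a < key z]| <= k }.

Lemma refine_key (T : finType) (f : T -> nat) : exists2 key : T -> nat,
  injective key & forall a b, key a <= key b -> f a <= f b.
Proof.
have lex m n p i j : i < n -> j < n -> m * n + i <= p * n + j -> m <= p by nia.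
pose g a := f a * #|T| + enum_rank a.
have gf a b : g a <= g b -> f a <= f b.
  exact: lex (ltn_ord (enum_rank a)) (ltn_ord (enum_rank b)).
exists g => // a b E; have fab : f a = f b.
  by apply/eqP; rewrite eqn_leq !gf ?E.
by move: E; rewrite /g fab => /addnI/val_inj/enum_rank_inj.
Qed.

(** Root the tree, order the vertices by the rank of their topmost bag, and let [chord] join
    vertices sharing a bag. The earlier neighbours of [z] then all lie in the topmost bag of [z],
    which makes them a clique of size at most [k]. *)
Lemma treewidth_elimination (M : sgraph) k :
  treewidth M k -> inhabited (elimination M k).
Proof.
case=> -[T [B [[treeT cover edge conB] width]]] _.
have [par [rk rt]] := tree_rooted treeT.
have top_ex v : exists t, (v \in B t) && [forall u, (v \in B u) ==> (rk t <= rk u)].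
  have [t0 vt0] := cover v.
  have [t vt tmin] := arg_minnP (P := fun t => v \in B t) rk vt0.
  by exists t; rewrite vt; apply/forallP=> u; apply/implyP; apply: tmin.
pose top v := xchoose (top_ex v).
have topB v : v \in B (top v) by case/andP: (xchooseP (top_ex v)).
have top_min v t : v \in B t -> rk (top v) <= rk t.
  by case/andP: (xchooseP (top_ex v)) => _ /forallP/(_ t)/implyP; apply.
have climb v t : v \in B t ->
    exists2 j, iter j par t = top v & forall i, i <= j -> v \in B (iter i par t).
  move=> vt; have [||u|j jt jA] := connected_rooted_iter rt (conB v) (x := top v) (t := t).
  - by rewrite inE.
  - by rewrite inE.
  - by rewrite inE => /top_min.
  - by exists j => // i /jA; rewrite inE.
have [rkI _ _ _] := rt.
(* Both vertices climb from the common bag [t]. If [v] stops first, its top is on the climb of [u];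
   otherwise the top of [u] contains [v], and the ranks force the two tops to coincide. *)
have in_top u v t : u \in B t -> v \in B t -> rk (top u) <= rk (top v) ->
    u \in B (top v).
  move=> /climb[i iu iB] /climb[j jv jB] le_uv.
  case: (leqP j i) => [ji|ij]; first by rewrite -jv; apply: iB.
  have /top_min vu : v \in B (top u) by rewrite -iu; apply/jB/ltnW.
  suff <- : top u = top v by [].
  by apply: rkI; rewrite ?in_setT //; apply/eqP; rewrite eqn_leq le_uv.
have [key keyI key_top] := refine_key (fun v => rk (top v)).
pose chord u v := (u != v) && [exists t, (u \in B t) && (v \in B t)].
have chord_top u v : chord u v -> key u <= key v -> u \in B (top v).
  by case/andP=> _ /existsP[t /andP[ut vt]] /key_top; apply: in_top vt.
constructor; exists key chord => //.
- move=> u v; rewrite /chord eq_sym; congr (_ && _).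
  by apply: eq_existsb => t; rewrite andbC.
- by move=> u; rewrite /chord eqxx.
- move=> u v uv; apply/andP; split; last exact/existsP/edge.
  by apply/eqP=> E; rewrite E sedge_irr in uv.
- move=> a b z az bz ltaz ltbz ab; rewrite /chord ab; apply/existsP.
  by exists (top z); rewrite !chord_top // ltnW.
move=> z; have: #|B (top z)| <= k.+1.
  have := leq_bigmax (F := fun t => #|B t|) (top z).
  by move/leq_trans; apply; rewrite -width leqSpred.
rewrite (cardsD1 z) topB ltnS; apply: leq_trans; apply: subset_leq_card.
apply/subsetP=> a; rewrite !inE => /andP[az ltaz].
by rewrite (chord_top _ _ az (ltnW ltaz)) andbT; case/andP: az.
Qed.

Lemma elimination_colouring (M : sgraph) k (el : elimination M k) :
  exists col : M -> 'I_k.+1, forall a b, chord el a b -> col a != col b.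
Proof.
exact: greedy_colouring (@chord_sym _ _ el) (@chord_irr _ _ el) (@key_inj _ _ el)
  (chord_few el).
Qed.

(** * The elimination forest *)

Section EliminationForest.
Variables (M : sgraph) (k : nat) (el : elimination M k).
Local Notation key := (key el).
Local Notation chord := (chord el).

Definition lower (v : M) : pred M := fun u => chord u v && (key u < key v).

(** The elimination forest of the chordal graph. Roots are fixed points, so ancestors are exactly
    the iterates of [parent]. *)
Definition parent (v : M) : M :=
  if [pick u | lower v u] is Some u0 then [arg max_(u > u0 | lower v u) key u] else v.

Lemma parentP v :
  (parent v = v /\ forall u, ~~ lower v u) \/
  (lower v (parent v) /\ forall u, lower v u -> key u <= key (parent v)).
Proof.
rewrite /parent; case: pickP => [u0 u0v|none]; last by left; split=> // u; rewrite none.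
by case: arg_maxnP => // u uv umax; right.
Qed.

(** Two lower neighbours of [v] are adjacent by simpliciality, and the parent is the one of largest
    key. *)
Lemma lower_parent v u : lower v u -> u != parent v -> lower (parent v) u.
Proof.
move=> uv upar; case: (parentP v) => [[_ /(_ u)]|[pv pmax]]; first by rewrite uv.
have := pmax u uv; rewrite leq_eqVlt (inj_eq (@key_inj _ _ el)) (negPf upar) /= => lt.
case/andP: uv => uv ltuv; case/andP: pv => pv ltpv.
by rewrite /lower lt andbT (chord_simplicial uv pv).
Qed.

Definition subtree (v : M) : {set M} := [set w | fconnect parent w v].

Lemma subtree_refl v : v \in subtree v.
Proof. by rewrite inE connect0. Qed.

Lemma subtree_trans u v w : u \in subtree v -> v \in subtree w -> u \in subtree w.
Proof. by rewrite !inE; apply: connect_trans. Qed.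

Lemma subtree_key w v : w \in subtree v -> key v <= key w.
Proof.
rewrite inE => /iter_findex <-; elim: (findex _ _ _) => //= n; apply: leq_trans.
by case: (parentP (iter n parent w)) => [[-> //]|[/andP[_ /ltnW]]].
Qed.

Lemma subtree_comparable u v w :
  u \in subtree v -> u \in subtree w -> v \in subtree w \/ w \in subtree v.
Proof.
rewrite !inE => /iter_findex; move: (findex _ _ _) => i <-.
move=> /iter_findex; move: (findex _ _ _) => j <-.
case: (leqP i j) => [|/ltnW] /subnK <-; rewrite iterD fconnect_iter; by [left|right].
Qed.

(** Climbing from [w], the vertex [u] remains a lower neighbour until it is itself the parent; hence
    chordal neighbours are always ancestor and descendant. *)
Lemma lower_subtree w u : lower w u -> w \in subtree u.
Proof.
have [n] := ubnP (key w); elim: n w => // n IHn w ltn uw.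
have wpar : w \in subtree (parent w) by rewrite inE fconnect1.
have [->//|upar] := eqVneq u (parent w).
apply: subtree_trans wpar (IHn _ _ (lower_parent uw upar)).
case: (parentP w) => [[_ /(_ u)]|[/andP[_ lt] _]]; first by rewrite uw.
by rewrite ltnS in ltn; apply: leq_trans ltn.
Qed.

Lemma subtree_lower v w u :
  w \in subtree v -> lower w u -> key u <= key v -> u = v \/ lower v u.
Proof.
rewrite inE => /iter_findex; move: (findex _ _ _) => n.
elim: n w => [|n IHn] w; first by move=> /= ->; right.
rewrite iterSr => wv uw uv; have [upar|upar] := eqVneq u (parent w); last first.
  exact: IHn wv (lower_parent uw upar) uv.
left; apply: (@key_inj _ _ el); apply/eqP; rewrite eqn_leq uv upar.
by apply: subtree_key; rewrite inE -wv fconnect_iter.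
Qed.

End EliminationForest.

(** * Building graphs by clique-width expressions *)

Section Build.
Variables (T L : finType).

(** The empty set is a separate case because no expression has the null graph as its value. Labels
    from [L] pass through [enum_rank] because expressions take ordinals. *)
Definition builds (E : rel T) (X : {set T}) (lab : T -> L) : Prop :=
  X = set0 \/ exists (e : cexpr #|L|) (h : cvalue e -> T),
    [/\ injective h, h @: setT = X, forall v w, sedge v w = E (h v) (h w)
      & forall v, label v = enum_rank (lab (h v))].

Lemma builds_single E x lab : irreflexive E -> builds E [set x] lab.
Proof.
move=> EI; right; exists (CVertex (enum_rank (lab x))), (fun _ => x); split=> //=.
- by move=> [] [].
- apply/setP=> y; rewrite inE; apply/imsetP/eqP => [[]//|->].
  by exists tt; rewrite ?inE.
Qed.

Lemma builds_eq E E' (X X' : {set T}) lab lab' : X = X' ->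
    {in X' &, E =2 E'} -> {in X', lab =1 lab'} ->
  builds E X lab -> builds E' X' lab'.
Proof.
move=> -> EE ll [->|[e [h [hI hX hE hl]]]]; [by left | right].
have hin v : h v \in X' by rewrite -hX imset_f ?inE.
by exists e, h; split=> // *; rewrite -?EE -?ll.
Qed.

Lemma builds_union E (X Y : {set T}) lab : symmetric E ->
    [disjoint X & Y] -> {in X & Y, forall x y, ~~ E x y} ->
  builds E X lab -> builds E Y lab -> builds E (X :|: Y) lab.
Proof.
move=> EC dXY noE [->|[e [h [hI hX hE hl]]]]; first by rewrite set0U.
move=> [->|[e' [h' [h'I h'Y h'E h'l]]]].
  by rewrite setU0; right; exists e, h.
have hin v : h v \in X by rewrite -hX imset_f ?inE.
have h'in v : h' v \in Y by rewrite -h'Y imset_f ?inE.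
have hh' v w : h v <> h' w.
  by move=> E0; move/pred0P: dXY => /(_ (h v)) /=; rewrite hin E0 h'in.
right; exists (CUnion e e'), (fun v => match v with inl v => h v | inr v => h' v end).
split=> [[v|v] [w|w]||[v|v] [w|w]|[v|v]] //=.
- by move/hI->.
- by move/hh'.
- by move/esym/hh'.
- by move/h'I->.
- apply/setP=> x; rewrite inE -hX -h'Y; apply/imsetP/orP => [[[v|v] _ ->]|].
  + by left; rewrite imset_f ?inE.
  + by right; rewrite imset_f ?inE.
  + case=> /imsetP[v _ ->]; [by exists (inl v); rewrite ?inE|by exists (inr v); rewrite ?inE].
- by rewrite (negPf (noE _ _ _ _)).
- by rewrite EC (negPf (noE _ _ _ _)).
Qed.

Lemma builds_independent E (X : {set T}) lab : symmetric E -> irreflexive E ->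
  {in X &, forall x y, ~~ E x y} -> builds E X lab.
Proof.
move=> EC EI; have [n] := ubnP #|X|; elim: n X => // n IHn X ltX noE.
have [->|[x xX]] := set_0Vmem X; first by left.
rewrite -(setD1K xX); apply: builds_union => //.
- by rewrite disjoints1 !inE eqxx.
- by move=> u w /set1P-> /setD1P[_ wX]; apply: noE.
- exact: builds_single.
apply: IHn; first by rewrite (cardsD1 x) xX ltnS in ltX.
by move=> u w /setD1P[_ uX] /setD1P[_ wX]; apply: noE.
Qed.

Lemma builds_join1 E X lab a b : a != b -> builds E X lab ->
  builds (fun x y => E x y || (x != y) &&
    ((lab x == a) && (lab y == b) || (lab y == a) && (lab x == b))) X lab.
Proof.
move=> ab [->|[e [h [hI hX hE hl]]]]; [by left | right].
have ab' : enum_rank a != enum_rank b by rewrite (inj_eq enum_rank_inj).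
exists (CJoin ab' e), h; split=> //= v w.
by rewrite /join_rel hE !hl !(inj_eq enum_rank_inj) (inj_eq hI).
Qed.

(** One [CJoin] per pair of labels related by [r]; irreflexivity gives the distinct labels that
    [CJoin] demands. *)
Lemma builds_join E X lab (r : rel L) : irreflexive r ->
  builds E X lab ->
  builds (fun x y => E x y || r (lab x) (lab y) || r (lab y) (lab x)) X lab.
Proof.
move=> rI bX.
suff Hs (s : seq (L * L)) : all (fun p => p.1 != p.2) s ->
    builds (fun x y => E x y || ((lab x, lab y) \in s) || ((lab y, lab x) \in s)) X lab.
  apply: builds_eq (Hs [seq p <- enum {: L * L} | r p.1 p.2] _) => //.
    move=> x y _ _; rewrite !(mem_filter (fun p : L * L => r p.1 p.2)).
    by rewrite !mem_enum /= !andbT.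
  apply/allP=> -[a b]; rewrite (mem_filter (fun p : L * L => r p.1 p.2)) => /andP[/= rab _].
  by apply: contraTneq rab => ->; rewrite rI.
elim: s => [_|[a b] s IHs /= /andP[ab /IHs bs]].
  by apply: builds_eq bX => // x y _ _; rewrite !in_nil !orbF.
apply: builds_eq (builds_join1 ab bs) => // x y _ _.
rewrite !inE !xpair_eqE; have [->|_ /=] := eqVneq x y; last first.
  by case: (_ && _); case: (_ && _); case: (E x y); case: (_ \in _); case: (_ \in _).
have abF : (lab y == a) && (lab y == b) = false.
  by apply: contraNF ab => /andP[/eqP<- /eqP<-].
by rewrite abF /= orbF.
Qed.

Lemma builds_relabel1 E X lab a b : a != b -> builds E X lab ->
  builds E X (fun x => if lab x == a then b else lab x).
Proof.
move=> ab [->|[e [h [hI hX hE hl]]]]; [by left | right].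
have ab' : enum_rank a != enum_rank b by rewrite (inj_eq enum_rank_inj).
exists (CRelabel ab' e), h; split=> //= v.
by rewrite hl (inj_eq enum_rank_inj); case: ifP.
Qed.

(** Idempotence allows relabelling one label at a time: the target of a move is fixed by [f] and so
    is never moved again. *)
Lemma builds_relabel E X lab (f : L -> L) : (forall a, f (f a) = f a) ->
  builds E X lab -> builds E X (f \o lab).
Proof.
move=> ff bX.
suff Hs (s : seq L) : builds E X (fun x => if lab x \in s then f (lab x) else lab x).
  by apply: builds_eq (Hs (enum L)) => // x _; rewrite mem_enum.
elim: s => [|a s IHs]; first exact: builds_eq bX.
have [fa|fa] := eqVneq a (f a).
  apply: builds_eq IHs => // x _; rewrite inE.
  by case: eqVneq => //= ->; rewrite -fa if_same.
apply: builds_eq (builds_relabel1 fa IHs) => // x _; rewrite inE.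
case: (eqVneq (lab x) a) => [->|xa] /=.
  by case: (a \in s); rewrite ?eqxx //; case: ifP.
case: (lab x \in s); last by rewrite (negPf xa).
by case: eqP => // fxa; rewrite -fxa ff eqxx in fa.
Qed.

End Build.

(** * Induced embeddings and decorated expressions *)

Lemma iso_induced_emb (G P : sgraph) (h : G -> P) : injective h ->
  (forall x y, sedge (h x) (h y) = sedge x y) -> iso_induced_subgraph G P.
Proof.
move=> hI hE; have hin x : h x \in h @: setT by rewrite imset_f ?inE.
exists (h @: setT); exists (fun x => exist _ (h x) (hin x)).
  have hex (w : induced (h @: setT)) : exists x, h x == val w.
    by case: w => w /= /imsetP[x _ ->]; exists x.
  exists (fun w => xchoose (hex w)) => [x|w].
    by apply: hI; apply/eqP/(xchooseP (hex (exist _ (h x) (hin x)))).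
  by apply: val_inj; apply/eqP/(xchooseP (hex w)).
by move=> x y; apply: hE.
Qed.

(** Give each created vertex [v] the decoration [g v]. Every join then adds only the pairs whose
    decorations are adjacent in [H], so the final edge set is cut down to these pairs. *)
Lemma hexpr_of_cexpr (H : lgraph) l (e : cexpr l) (g : cvalue e -> H) :
  exists (e' : hexpr H l) (h : cvalue e -> hvalue e'),
    [/\ bijective h, forall v, label (h v) = (label v, g v)
      & forall v w, sedge (h v) (h w) = sedge v w && ledge (g v) (g w)].
Proof.
elim: e g => [i|e1 IH1 e2 IH2|i j ij e IH|i j ij e IH] /= g.
- exists (HVertex i (g tt)), id; split=> //; first by exists id.
  by case.
- have [e1' [h1 [[h1' h1K h1'K] l1 E1]]] := IH1 (fun v => g (inl v)).
  have [e2' [h2 [[h2' h2K h2'K] l2 E2]]] := IH2 (fun v => g (inr v)).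
  exists (HUnion e1' e2'), (fun v => match v with inl v => inl (h1 v) | inr v => inr (h2 v) end).
  split=> [|[v|v]|[v|v] [w|w]] //=.
  exists (fun v => match v with inl v => inl (h1' v) | inr v => inr (h2' v) end).
    by case=> v; rewrite ?h1K ?h2K.
  by case=> v; rewrite ?h1'K ?h2'K.
- have [e' [h [hB hl hE]]] := IH g.
  exists (HJoin ij e'), h; split=> //= v w.
  rewrite /join_rel hE !hl /= (inj_eq (bij_inj hB)) [ledge (g w) _]ledge_sym.
  by case: (ledge _ _); rewrite ?andbT ?andbF.
- have [e' [h [hB hl hE]]] := IH g.
  by exists (HRelabel ij e'), h; split=> //= v; rewrite hl /=; case: ifP.
Qed.

(** * Coding the neighbourhoods of G *)

Section Coding.
Variables (Q M G : sgraph) (k d : nat) (el : elimination M k).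
Variables (col : M -> 'I_k.+1) (c : Q -> 'I_d) (f : G -> strong_product Q M).
Hypothesis colP : forall a b, chord el a b -> col a != col b.
Hypothesis cP : forall x y, @sedge (square Q) x y -> c x != c y.
Hypothesis f_inj : injective f.
Hypothesis f_hom : forall x y, sedge x y -> sedge (f x) (f y).

Local Notation key := (key el).
Local Notation q x := (f x).1.
Local Notation m x := (f x).2.

Lemma colour_inj p a b : refl_rel p a -> refl_rel p b -> c a = c b -> a = b.
Proof.
move=> pa pb cab; apply/eqP/contraT => /(square_sedge pa pb)/cP.
by rewrite cab eqxx.
Qed.

Lemma edge_Q x y : sedge x y -> refl_rel (q x) (q y).
Proof.
by case/f_hom/or3P=> /andP[xy _]; rewrite /refl_rel xy ?orbT.
Qed.

Lemma edge_M x y : sedge x y -> (m x == m y) || sedge (m x) (m y).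
Proof.
by case/f_hom/or3P=> /andP[_ xy]; rewrite xy ?orbT.
Qed.

Lemma edge_lower x y : sedge x y ->
  [\/ m x = m y, lower el (m x) (m y) | lower el (m y) (m x)].
Proof.
move/edge_M; have [->|xy /= /chord_sedge] := eqVneq (m x) (m y); first by constructor.
move/(_ _ el) => ch; rewrite /lower ch chord_sym ch /=.
case: (ltngtP (key (m x)) (key (m y))) => [||/key_inj E]; [by constructor..|].
by rewrite E eqxx in xy.
Qed.

Lemma edge_lower_leq x y : sedge x y -> key (m y) <= key (m x) ->
  m y = m x \/ lower el (m x) (m y).
Proof.
move=> /edge_lower[->|xy _|/andP[_]]; [by left|by right|].
by move=> ltxy leyx; rewrite ltnNge leyx in ltxy.
Qed.

(** A vertex together with its lower neighbours is a clique of [chord], on which [col] is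
    injective. *)
Lemma lower_col_inj w a b :
  a = w \/ lower el w a -> b = w \/ lower el w b -> col a = col b -> a = b.
Proof.
have ne u : lower el w u -> col u != col w by case/andP=> /colP.
move=> [->|wa] [->|wb] // cab.
- by have := ne _ wb; rewrite cab eqxx.
- by have := ne _ wa; rewrite cab eqxx.
apply/eqP/contraT => ab; case/andP: wa wb => cha lta /andP[chb ltb].
by have := colP (chord_simplicial cha chb lta ltb ab); rewrite cab eqxx.
Qed.

(* Whether the pair of [m y] and the colour of [q y] names a neighbour of [x]
   that [x] is responsible for: [y] itself whenever [q y] is [q x] or adjacent
   to it. *)
Definition points_to (x y : G) : bool :=
  (key (m y) <= key (m x)) &&
  [exists z, [&& sedge x z, m z == m y & c (q z) == c (q y)]].

(** The witness [z] and [y] lie over the same vertex of [M], and their [Q]-coordinates have the same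
    colour within the closed neighbourhood of [q x]; so they coincide. *)
Lemma points_to_edge x y : refl_rel (q x) (q y) -> points_to x y -> sedge x y.
Proof.
move=> xy /andP[_ /existsP[z /and3P[xz /eqP mz /eqP cz]]].
suff <- : z = y by [].
by apply: f_inj; apply: injective_projections mz; apply: colour_inj (edge_Q xz) xy cz.
Qed.

Lemma edge_points_to x y : sedge x y -> points_to x y || points_to y x.
Proof.
move=> xy; have [le|/ltnW le] := leqP (key (m y)) (key (m x)).
  apply/orP; left; rewrite /points_to le; apply/existsP; exists y.
  by rewrite xy !eqxx.
apply/orP; right; rewrite /points_to le; apply/existsP; exists x.
by rewrite sedge_sym xy !eqxx.
Qed.

Lemma edgeE x y :
  sedge x y = refl_rel (q x) (q y) && (points_to x y || points_to y x).
Proof.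
apply/idP/andP => [xy|[xy]]; first by rewrite edge_Q ?edge_points_to.
case/orP; first exact: points_to_edge.
by rewrite sedge_sym; apply: points_to_edge; rewrite refl_rel_sym.
Qed.

(** Common criterion for both constructions: [g] will be the identity for [M1] and [quotient_map]
    for [M2]. If [g] identifies [x] and [y] over equal or adjacent vertices of [Q], the colours
    force [x = y]. *)
Lemma strong_edgeE (P : sgraph) (g : G -> P) x y :
    (forall x y, sedge (g x) (g y) = (g x != g y) && (points_to x y || points_to y x)) ->
    (forall x y, g x = g y -> m x = m y /\ c (q x) = c (q y)) ->
  sedge x y = refl_rel (q x) (q y) && sedge (g x) (g y).
Proof.
move=> gE gI; rewrite edgeE gE; case xy: (refl_rel _ _) => //=.
have [/gI[mxy cxy]|] //= := eqVneq (g x) (g y).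
have <- : x = y.
  apply: f_inj; apply: injective_projections mxy.
  by apply: colour_inj xy cxy; rewrite /refl_rel eqxx.
apply/negbTE/negP; rewrite orbb => /points_to_edge; rewrite /refl_rel eqxx !sedge_irr.
by move/(_ isT).
Qed.

Lemma code_embedding (P : sgraph) (g : G -> P) :
    (forall x y, sedge (g x) (g y) = (g x != g y) && (points_to x y || points_to y x)) ->
    (forall x y, g x = g y -> m x = m y /\ c (q x) = c (q y)) ->
  iso_induced_subgraph G (strong_product Q P).
Proof.
move=> gE gI; apply: (@iso_induced_emb G (strong_product Q P) (fun x => (q x, g x))).
  by move=> x y [qxy /gI[mxy _]]; apply: f_inj; apply: injective_projections.
move=> x y; rewrite (strong_edgeE x y gE gI) /= /strong_rel /= /refl_rel.
have [/gI[mxy cxy]|ne] := eqVneq (g x) (g y); last first.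
  by rewrite andbF orbF -andb_orl orbC.
have [->|ne] := eqVneq (q x) (q y); first by rewrite sedge_irr /= orbF.
case xy: (sedge (q x) (q y)) => /=; last by [].
by case/eqP: ne; apply: (@colour_inj (q x)) cxy; rewrite /refl_rel ?eqxx ?xy ?orbT.
Qed.

Local Notation small := {A : {set 'I_d} | #|A| <= (max_degree Q).+1}.

Lemma small_set0 : #|@set0 'I_d| <= (max_degree Q).+1.
Proof. by rewrite cards0. Qed.

Definition small0 : small := exist _ set0 small_set0.

(** The filter [P] is [key u <= key (m x)] for the tree-width construction and [u \notin C], with
    [C] the processed part of [M], for clique-width. *)
Definition refs (P : pred M) (x : G) (p : 'I_k.+1) : {set 'I_d} :=
  [set i | [exists y, [&& sedge x y, col (m y) == p, P (m y) & c (q y) == i]]].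

Lemma refs_small P x p : #|refs P x p| <= (max_degree Q).+1.
Proof.
have: #|q x |: [set y | sedge (q x) y]| <= (max_degree Q).+1.
  by rewrite cardsU1 inE sedge_irr add1n ltnS degree_leq.
apply: leq_trans; apply: leq_trans (leq_imset_card c _); apply: subset_leq_card.
apply/subsetP=> i; rewrite inE => /existsP[y /and4P[xy _ _ /eqP<-]].
by apply: imset_f; rewrite !inE eq_sym; apply: edge_Q.
Qed.

Definition code P x : {ffun 'I_k.+1 -> small} := [ffun p => insubd small0 (refs P x p)].

Lemma val_code P x p : val (code P x p) = refs P x p.
Proof. by rewrite ffunE insubdK // unfold_in refs_small. Qed.

Lemma eq_code (P P' : pred M) x :
  (forall y, sedge x y -> P (m y) = P' (m y)) -> code P x = code P' x.
Proof.
move=> PP; apply/ffunP=> p; apply: val_inj; rewrite !val_code.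
apply/setP=> i; rewrite !inE; apply: eq_existsb => y.
by case xy: (sedge x y); rewrite //= PP.
Qed.

(** * Tree-width *)

Definition quotient_vertex : finType := (M * 'I_d * {ffun 'I_k.+1 -> small})%type.

(** The relation [points_to] read off from codes. Demanding equal or adjacent vertices of [M] makes
    every edge fit into a blown-up bag. *)
Definition quotient_points (w w' : quotient_vertex) : bool :=
  [&& key w'.1.1 <= key w.1.1, (w.1.1 == w'.1.1) || sedge w.1.1 w'.1.1
    & w'.1.2 \in val (w.2 (col w'.1.1))].

Definition quotient_rel : rel quotient_vertex := fun w w' =>
  (w != w') && (quotient_points w w' || quotient_points w' w).

Lemma quotient_rel_sym : symmetric quotient_rel.
Proof. by move=> w w'; rewrite /quotient_rel eq_sym orbC. Qed.

Lemma quotient_rel_irr : irreflexive quotient_rel.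
Proof. by move=> w; rewrite /quotient_rel eqxx. Qed.

Definition quotient_graph : sgraph := SGraph quotient_rel_sym quotient_rel_irr.

Definition quotient_map (x : G) : quotient_graph :=
  (m x, c (q x), code (fun u => key u <= key (m x)) x).

(** A code names a vertex of [M] only by its colour; [lower_col_inj] recovers the vertex. *)
Lemma quotient_pointsE x y :
  quotient_points (quotient_map x) (quotient_map y) = points_to x y.
Proof.
rewrite /quotient_points /points_to val_code /=; case: leqP => //= le.
apply/andP/existsP => [[xy]|[z /and3P[xz /eqP mz cz]]]; last first.
  rewrite inE -mz edge_M //; split=> //; apply/existsP; exists z.
  by rewrite xz eqxx cz mz le.
rewrite inE => /existsP[z /and4P[xz /eqP colz lez cz]]; exists z.
rewrite xz cz andbT /=; apply/eqP; apply: lower_col_inj colz.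
  exact: edge_lower_leq xz lez.
case: eqVneq xy => [E _|ne /= xy]; [by left|right].
rewrite /lower chord_sym chord_sedge //= ltn_neqAle le andbT.
by rewrite (inj_eq (@key_inj _ _ el)) eq_sym.
Qed.

Lemma quotient_embedding :
  iso_induced_subgraph G (strong_product Q quotient_graph).
Proof.
apply: (@code_embedding quotient_graph quotient_map) => [x y|x y [-> -> _]] //.
by rewrite /= /quotient_rel !quotient_pointsE.
Qed.

Lemma quotient_treewidth w : treewidth M w ->
  exists2 l, treewidth quotient_graph l &
    l <= (w + 1) * d * #|{: small}| ^ (k + 1).
Proof.
rewrite !addn1.
case=> -[T [B [[treeT cover edge conB] width]]] _.
pose B' (t : T) : {set quotient_graph} := [set u : quotient_graph | u.1.1 \in B t].
have dec : tree_decomposition B'.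
  split=> // [u|u v uv|u].
  - by have [t ut] := cover u.1.1; exists t; rewrite inE.
  - wlog uv' : u v uv / quotient_points u v.
      move=> W; case/andP: (uv) => _ /orP[/W|/W]; first exact.
      by rewrite sedge_sym => /(_ uv)[t tP]; exists t; rewrite andbC.
    case/and3P: uv' => _ /orP[/eqP uv'|uv'] _.
      by have [t ut] := cover u.1.1; exists t; rewrite !inE -uv' ut.
    by have [t tP] := edge _ _ uv'; exists t; rewrite !inE.
  - suff -> : [set t | u \in B' t] = [set t | u.1.1 \in B t] by apply: conB.
    by apply/setP=> t; rewrite !inE.
have [|l lw le] := @ex_is_least (fun n => exists (T : sgraph)
  (B : T -> {set quotient_graph}), tree_decomposition B /\ bag_width B = n) (bag_width B').
  by exists T, B'.
(* The decrement in [bag_width] is given away for the blown-up bags; for [M] it is what turns width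
   [w] into bags of size at most [w + 1]. *)
exists l => //; apply: leq_trans le _; apply: leq_trans (leq_pred _) _.
apply/bigmax_leqP => t _.
have -> : #|B' t| = #|B t| * d * #|{: small}| ^ k.+1.
  have -> : B' t = setX (setX (B t) setT) setT.
    by apply/setP=> -[[u i] S]; rewrite !inE /= !andbT.
  by rewrite !cardsX !cardsT card_ord card_ffun card_ord.
rewrite !leq_mul // -width; apply: leq_trans (leqSpred _).
exact: (leq_bigmax (F := fun t => #|B t|)).
Qed.


(** * Clique-width *)

Definition pointing_rel : rel G := fun x y =>
  (x != y) && (points_to x y || points_to y x).

Lemma pointing_rel_sym : symmetric pointing_rel.
Proof. by move=> x y; rewrite /pointing_rel eq_sym orbC. Qed.

Lemma pointing_rel_irr : irreflexive pointing_rel.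
Proof. by move=> x; rewrite /pointing_rel eqxx. Qed.

Definition pointing_graph : sgraph := SGraph pointing_rel_sym pointing_rel_irr.

Lemma pointing_embedding :
  iso_induced_subgraph G (strong_product Q pointing_graph).
Proof. by apply: (@code_embedding pointing_graph id) => // x y ->. Qed.

Lemma pointing_lower x y : pointing_rel x y ->
  [\/ m x = m y, lower el (m x) (m y) | lower el (m y) (m x)].
Proof.
case/andP=> _ /orP[] /andP[_ /existsP[z /and3P[/edge_lower + /eqP <- _]]] //.
by case; [constructor 1|constructor 3|constructor 2].
Qed.

(** Such a set is a union of full subtrees of the elimination forest, the shape of a processed part
    of [M]. *)
Definition up_closed (C : {set M}) : Prop :=
  forall u w, u \in C -> lower el w u -> w \in C.

(** [Some i] marks a vertex over the [M]-vertex being processed, [None] an older one; this option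
    accounts for the factor [d + 1]. *)
Definition cw_label : finType := (option 'I_d * {ffun 'I_k.+1 -> small})%type.

Definition outer_code (C : {set M}) x := code (fun u => u \notin C) x.

Definition over (C : {set M}) : {set G} := [set x | m x \in C].

Lemma in_over C x : (x \in over C) = (m x \in C).
Proof. by rewrite inE. Qed.

Section UpClosed.
Variables (C : {set M}) (v : M).
Hypothesis C_closed : up_closed C.
Hypothesis vC : v \in C.
Hypothesis v_min : forall u, u \in C -> key v <= key u.
Local Notation D := (subtree el v).

Lemma subtree_up_closed : up_closed D.
Proof. by move=> u w uD /lower_subtree wu; apply: subtree_trans wu uD. Qed.

Lemma subtree_sub : D \subset C.
Proof.
apply/subsetP=> w; rewrite inE => /iter_findex; move: (findex _ _ _) => n.
elim: n w => [|n IHn] w; first by move=> /= ->.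
rewrite iterSr => /IHn pC; case: (parentP el w) => [[<- _]//|[pw _]].
exact: C_closed pw.
Qed.

(** A lower neighbour outside [D] of a vertex of [D] would be a proper ancestor of [v],
    contradicting that [v] has the least key in [C]. *)
Lemma subtree_separated w w' : w \in D -> w' \in C :\: D ->
  ~ [\/ w = w', lower el w w' | lower el w' w].
Proof.
move=> wD /setDP[w'C w'D]; case=> [E|/lower_subtree ww'|/lower_subtree w'w].
- by rewrite -E wD in w'D.
- case: (subtree_comparable wD ww') => [vw'|w'v]; last by rewrite w'v in w'D.
  have E : v = w'.
    apply: (@key_inj _ _ el); apply/eqP.
    by rewrite eqn_leq v_min // subtree_key.
  by rewrite -E subtree_refl in w'D.
by rewrite (subtree_trans w'w wD) in w'D.
Qed.

Lemma rest_up_closed : up_closed (C :\: D).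
Proof.
move=> u w uR wu; have [uC _] := setDP uR.
apply/setDP; split; first exact: C_closed wu.
by apply/negP=> wD; apply: (subtree_separated wD uR); constructor 2.
Qed.

Lemma subtree_minus_up_closed : up_closed (D :\ v).
Proof.
move=> u w /setD1P[_ uD] wu; apply/setD1P; split; last exact: subtree_up_closed wu.
apply/eqP=> E; case/andP: wu => _; rewrite E ltnNge.
by rewrite subtree_key.
Qed.

Lemma outer_code_subtree x : m x \in D -> outer_code C x = outer_code D x.
Proof.
move=> xD; apply: eq_code => y /edge_lower xy.
have [yD|yD] := boolP (m y \in D); first by rewrite (subsetP subtree_sub).
by apply/negP=> yC; apply: (@subtree_separated (m x) (m y)) => //; apply/setDP.
Qed.

Lemma outer_code_rest x : m x \in C :\: D -> outer_code C x = outer_code (C :\: D) x.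
Proof.
move=> xR; apply: eq_code => y; rewrite sedge_sym => /edge_lower yx.
rewrite in_setD negb_and negbK; have [yD|//] := boolP (m y \in D).
by case: (subtree_separated yD xR yx).
Qed.

(** Otherwise [m y] is a proper ancestor of [v] and a lower neighbour of a descendant of [v], hence
    a lower neighbour of [v], and its colour differs from that of [v]. So a code entry at [col v]
    can refer only to [v]. *)
Lemma outer_ref_unique x y : m x \in D -> sedge x y -> col (m y) = col v ->
  m y \notin D :\ v -> m y = v.
Proof.
move=> xD xy cy; rewrite in_setD1 negb_and negbK => /orP[/eqP//|yD].
case: (edge_lower xy) => [E|xy'|/lower_subtree yx].
- by rewrite -E xD in yD.
- case: (subtree_comparable xD (lower_subtree xy')) => [vy|yv]; last by rewrite yv in yD.
  case: (subtree_lower xD xy' (subtree_key vy)) => // /andP[/colP].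
  by rewrite cy eqxx.
by rewrite (subtree_trans yx xD) in yD.
Qed.

(** The test [i != j] keeps a label from being joined to itself. It loses no edge: a vertex over [v]
    never points to another one over [v] with its own colour, as [joined_points] shows. *)
Definition joined (a b : cw_label) : bool :=
  if b.1 is Some i then
    (i \in val (a.2 (col v))) && (if a.1 is Some j then i != j else true)
  else false.

Lemma joined_irr : irreflexive joined.
Proof. by move=> [[i|] S]; rewrite /joined //= eqxx andbF. Qed.

Definition forget (a : cw_label) : cw_label :=
  (None, [ffun p => if p == col v then small0 else a.2 p]).

Lemma forget_idem a : forget (forget a) = forget a.
Proof. by congr (_, _); apply/ffunP=> p; rewrite !ffunE; case: eqP. Qed.

Definition new_label x : cw_label :=
  (if m x == v then Some (c (q x)) else None, outer_code (D :\ v) x).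

Lemma forget_new_label x : m x \in D -> forget (new_label x) = (None, outer_code D x).
Proof.
move=> xD; congr (_, _); apply/ffunP=> p; apply: val_inj; rewrite ffunE /=.
rewrite !(fun_if val) !val_code /=; apply/setP=> i.
case: eqVneq => [->|pv]; rewrite !inE.
  apply/esym/existsP=> -[y /and4P[xy /eqP cy yD _]].
  have E : m y = v.
    by apply: outer_ref_unique xy cy _ => //; apply: contra yD => /setD1P[].
  by rewrite E subtree_refl in yD.
apply: eq_existsb => y; rewrite in_setD1; case: (sedge x y) => //=.
case: eqVneq => //= cy; congr (~~ _ && _).
by case: eqVneq => // E; rewrite -cy E eqxx in pv.
Qed.

Lemma joined_points x y : m x \in D -> m y = v ->
  joined (new_label x) (new_label y) = points_to x y && (x != y).
Proof.
move=> xD yv; rewrite /joined /new_label /= yv eqxx val_code inE.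
have -> : points_to x y = [exists z,
    [&& sedge x z, col (m z) == col v, m z \notin D :\ v & c (q z) == c (q y)]].
  rewrite /points_to yv subtree_key //=; apply: eq_existsb => z.
  apply/and3P/and4P=> [[xz /eqP-> ->]|[xz /eqP cz zD ->]].
    by rewrite xz eqxx in_setD1 eqxx.
  by rewrite xz (outer_ref_unique xD xz cz zD).
case: existsP => //= -[z /and4P[xz /eqP cz zD /eqP czy]].
have zv := outer_ref_unique xD xz cz zD.
case: eqVneq => [xv|xv]; last first.
  by symmetry; apply/eqP=> E; rewrite E yv eqxx in xv.
(* Both [x] and its neighbour [z] lie over [v]; equal colours would make them equal and give a
   loop. *)
have xz_ne : c (q y) != c (q x).
  rewrite -czy; apply/eqP=> E.
  have qq : q x = q z by apply: colour_inj (edge_Q xz) (esym E); rewrite /refl_rel eqxx.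
  have xzE : x = z by apply: f_inj; apply: injective_projections; rewrite ?xv.
  by rewrite xzE sedge_irr in xz.
rewrite xz_ne; symmetry; apply/eqP=> E.
by rewrite E eqxx in xz_ne.
Qed.

Lemma points_to_above x y : m x = v -> m y \in D -> m y != v -> points_to x y = false.
Proof.
move=> xv yD; apply: contraNF => /andP[le _]; apply/eqP/(@key_inj _ _ el)/eqP.
by rewrite eqn_leq -{1}xv le subtree_key.
Qed.

(** Add the vertices over [v] as an independent set, create all edges at them by [joined], then
    [forget] their colours and the references to [v]. The relation [E0] is the graph before these
    edges are added. *)
Lemma builds_subtree :
    builds pointing_rel (over (D :\ v)) (fun x => (None, outer_code (D :\ v) x) : cw_label) ->
  builds pointing_rel (over D) (fun x => (None, outer_code D x) : cw_label).
Proof.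
move=> bX0.
pose E0 : rel G := fun x y => [&& pointing_rel x y, m x != v & m y != v].
have E0C : symmetric E0.
  by move=> x y; rewrite /E0 pointing_rel_sym; congr (_ && _); rewrite andbC.
have E0I : irreflexive E0 by move=> x; rewrite /E0 pointing_rel_irr.
pose X1 := [set x | m x == v].
have b0 : builds E0 (over (D :\ v)) new_label.
  apply: builds_eq bX0 => //.
    move=> x y; rewrite !in_over !in_setD1 => /andP[xv _] /andP[yv _].
    by rewrite /E0 xv yv !andbT.
  by move=> x; rewrite in_over in_setD1 /new_label => /andP[/negPf-> _].
have b1 : builds E0 X1 new_label.
  by apply: builds_independent => // x y; rewrite inE /E0 => ->; rewrite andbF.
have b01 : builds E0 (over (D :\ v) :|: X1) new_label.
  apply: builds_union => //.
    apply/pred0P=> x; rewrite /= in_over in_setD1 /X1 in_set.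
    by case: eqVneq; rewrite ?andbF.
  by move=> x y _; rewrite inE /E0 => ->; rewrite !andbF.
have nj x y : m y != v -> joined (new_label x) (new_label y) = false.
  by rewrite /joined /new_label /= => /negPf->.
apply: builds_eq (builds_relabel forget_idem (builds_join joined_irr b01)) => [|x y|x].
- apply/setP=> x; rewrite in_setU !in_over in_setD1 /X1 in_set.
  by case: eqVneq => [->|] /=; rewrite ?subtree_refl ?orbF.
- rewrite !in_over /E0 => xD yD; rewrite /pointing_rel.
  have [xv|xv] := eqVneq (m x) v; have [yv|yv] := eqVneq (m y) v => /=.
  + rewrite andbF /= !joined_points // (eq_sym y x).
    by rewrite -andb_orl andbC.
  + rewrite andbF /= nj // joined_points // (points_to_above xv) //.
    by rewrite eq_sym andbC.
  + rewrite andbF /= (nj y) // joined_points // (points_to_above yv) //.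
    by rewrite !orbF andbC.
  + by rewrite andbT !nj // !orbF.
by rewrite in_over => /forget_new_label.
Qed.

End UpClosed.

(** Induction on the size of [C]: split off the subtree [D] of the vertex [v] of least key, build it
    from [D :\ v], and unite it with the part over the rest, to which no edge leads. *)
Lemma builds_up_closed C : up_closed C ->
  builds pointing_rel (over C) (fun x => (None, outer_code C x) : cw_label).
Proof.
have [n] := ubnP #|C|; elim: n C => // n IHn C ltC Ccl.
have [->|[v0 v0C]] := set_0Vmem C.
  by left; apply/setP=> x; rewrite in_over !inE.
have [v vC vmin] := arg_minnP (P := fun v => v \in C) key v0C.
have DC := subtree_sub Ccl vC; have vD := subtree_refl el v.
pose D := subtree el v.
have bD : builds pointing_rel (over D) (fun x => (None, outer_code D x) : cw_label).
  apply: builds_subtree; apply: IHn; last exact: subtree_minus_up_closed.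
  rewrite -ltnS; apply: leq_trans ltC; rewrite ltnS.
  by apply: leq_trans (subset_leq_card DC); rewrite [X in _ < X](cardsD1 v) vD.
have bR : builds pointing_rel (over (C :\: D))
    (fun x => (None, outer_code (C :\: D) x) : cw_label).
  apply: IHn; last exact: rest_up_closed.
  rewrite -ltnS; apply: leq_trans ltC; rewrite ltnS; apply: proper_card.
  by apply/properP; split; [apply: subsetDl|exists v; rewrite // in_setD vD].
have overE : over C = over D :|: over (C :\: D).
  apply/setP=> x; rewrite in_setU !in_over in_setD.
  by case: (boolP (m x \in D)) => //= /(subsetP DC).
rewrite overE; apply: builds_union.
- exact: pointing_rel_sym.
- by apply/pred0P=> x /=; rewrite !in_over in_setD; case: (m x \in D).
- move=> x y; rewrite !in_over => xD yR; apply/negP=> /pointing_lower.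
  exact: (subtree_separated vmin xD yR).
- apply: builds_eq bD => // x; rewrite in_over => xD.
  by rewrite (outer_code_subtree Ccl vC vmin xD).
- apply: builds_eq bR => // x; rewrite in_over => xR.
  by rewrite (outer_code_rest vmin xR).
Qed.

Lemma pointing_clique_width :
  exists2 l, clique_width pointing_graph l & l <= (d + 1) * #|{: small}| ^ (k + 1).
Proof.
have -> : (d + 1) * #|{: small}| ^ (k + 1) = #|cw_label|.
  by rewrite card_prod card_option card_ord card_ffun card_ord !addn1.
apply: ex_is_least; split.
  by apply/card_gt0P; exists (None, [ffun => small0]).
have [|E|[e [h [hI hX hE _]]]] := @builds_up_closed setT; first by [].
  left; apply/eqP; rewrite -cardsT cards_eq0 -E; apply/eqP/setP=> x.
  by rewrite in_over !inE.
right; exists e; have [||g hK gK] := @inj_card_bij _ _ h; first exact: hI.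
  rewrite -[#|cvalue e|]cardsT -(card_imset _ hI) hX -cardsT.
  by apply: subset_leq_card; apply/subsetP=> x; rewrite in_over !inE.
exists g; first by exists h.
by move=> x y; rewrite hE !gK.
Qed.

Lemma pointing_hclique_width l (HH : lgraph -> Prop) :
    clique_width pointing_graph l -> HH (reflexive_closure Q) ->
  exists2 h, hclique_width HH G h & h <= l.
Proof.
case=> -[l0 pl] _ HQ; apply: ex_is_least; split=> //.
exists (reflexive_closure Q) => //.
case: pl => [G0|[e [g [g' gK g'K] gE]]]; [by left|right].
have [e' [h [hB _ hE]]] := @hexpr_of_cexpr (reflexive_closure Q) l e (fun v => q (g' v)).
exists e', (h \o g); first by apply: bij_comp => //; exists g'.
move=> x y /=; rewrite hE gE !gK /= andbC.
by rewrite (@strong_edgeE pointing_graph id) // => ? ? ->.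
Qed.

End Coding.

Theorem theorem5p2 (Q M G : sgraph) (Delta k : nat)
    (hDelta : max_degree Q = Delta) (hDelta2 : 2 <= Delta)
    (hM : treewidth M k)
    (hG : subgraph G (strong_product Q M)) :
  (* a) *)
  (exists (M1 : sgraph) (l : nat),
    [/\ clique_width M1 l,
        l <= (Delta ^ 2 + 2) * Delta ^ (2 * (Delta + 1) * (k + 1)),
        iso_induced_subgraph G (strong_product Q M1)
      & forall HH : lgraph -> Prop, HH (reflexive_closure Q) ->
          exists2 h : nat, hclique_width HH G h & h <= l]) /\
  (* b) *)
  (exists (M2 : sgraph) (l' : nat),
    [/\ treewidth M2 l',
        l' <= (k + 1) * (Delta ^ 2 + 1) * Delta ^ (2 * (Delta + 1) * (k + 1))
      & iso_induced_subgraph G (strong_product Q M2)]) /\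
  (* furthermore *)
  (forall d : nat, colourable (square Q) d ->
    (exists (M1 : sgraph) (l : nat),
      [/\ clique_width M1 l,
          l <= (d + 1) * (minn ((d - 1) ^ (Delta + 1)) (2 ^ d)) ^ (k + 1),
          iso_induced_subgraph G (strong_product Q M1)
        & forall HH : lgraph -> Prop, HH (reflexive_closure Q) ->
            exists2 h : nat, hclique_width HH G h & h <= l]) /\
    (exists (M2 : sgraph) (l' : nat),
      [/\ treewidth M2 l',
          l' <= (k + 1) * d * (minn ((d - 1) ^ (Delta + 1)) (2 ^ d)) ^ (k + 1)
        & iso_induced_subgraph G (strong_product Q M2)])).
Proof.
have [el] := treewidth_elimination hM.
have [col colP] := elimination_colouring el.
have [f f_inj f_hom] := hG.
have core d : colourable (square Q) d ->
    (exists (M1 : sgraph) (l : nat),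
      [/\ clique_width M1 l,
          l <= (d + 1) * (minn ((d - 1) ^ (Delta + 1)) (2 ^ d)) ^ (k + 1),
          iso_induced_subgraph G (strong_product Q M1)
        & forall HH : lgraph -> Prop, HH (reflexive_closure Q) ->
            exists2 h : nat, hclique_width HH G h & h <= l]) /\
    (exists (M2 : sgraph) (l' : nat),
      [/\ treewidth M2 l',
          l' <= (k + 1) * d * (minn ((d - 1) ^ (Delta + 1)) (2 ^ d)) ^ (k + 1)
        & iso_induced_subgraph G (strong_product Q M2)]).
  move=> sqQ.
  have [c cP] : exists c : Q -> 'I_d, forall x y, @sedge (square Q) x y -> c x != c y.
    exact: sqQ.
  (* The count of small sets needs both [d] and [Delta + 1] to exceed two. *)
  have d2 : 2 < d by case: (max_degree_colours sqQ) => //; rewrite hDelta ltnNge hDelta2.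
  have small_leq : #|{: {A : {set 'I_d} | #|A| <= (max_degree Q).+1}}| <=
      minn ((d - 1) ^ (Delta + 1)) (2 ^ d).
    by rewrite addn1 -hDelta card_small_sets_leq // hDelta ltnS.
  split.
    have [l lw le] := pointing_clique_width (Q := Q) colP cP f_inj f_hom.
    exists (pointing_graph (Q := Q) el c f), l; split=> //.
    - by apply: leq_trans le _; rewrite leq_mul2l leq_exp2r ?small_leq ?orbT // addn1.
    - exact: (pointing_embedding (Q := Q) el cP f_inj f_hom).
    - by move=> HH; apply: (pointing_hclique_width (Q := Q) cP f_inj f_hom lw).
  have [l lw le] := quotient_treewidth Q d el col hM.
  exists (quotient_graph Q d el col), l; split=> //.
    by apply: leq_trans le _; rewrite leq_mul2l leq_exp2r ?small_leq ?orbT // addn1.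
  exact: (quotient_embedding (Q := Q) colP cP f_inj f_hom).
(* The square has a colouring with [d = Delta^2 + 1] colours; then [(d - 1)^(Delta + 1) = Delta^(2
   (Delta + 1))], which yields a) and b). *)
have [[M1 [l [lw le emb hcw]]] [M2 [l' [l'w l'e emb']]]] := core _ (square_colourable Q).
have pow_leq : minn ((Delta ^ 2) ^ (Delta + 1)) (2 ^ (Delta ^ 2).+1) ^ (k + 1)
    <= Delta ^ (2 * (Delta + 1) * (k + 1)).
  by rewrite !expnM leq_exp2r ?addn1 // geq_minl.
rewrite hDelta subSS subn0 in le l'e.
split; last split=> //.
- exists M1, l; split=> //; apply: leq_trans le _.
  by rewrite addn1 addn2 leq_mul2l pow_leq orbT.
- exists M2, l'; split=> //; apply: leq_trans l'e _.
  by rewrite [Delta ^ 2 + 1]addn1 leq_mul2l pow_leq orbT.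
Qed.
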